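(* Let $S\in\mathbb{R}^{\nu\times\nu}$, $L\in\mathbb{R}^{1\times\nu}$, $Q\in\mathbb{R}^{\nu\times\nu}$, $R\in\mathbb{R}^{\nu}$ be such that the pair $(L,S)$ is observable and the pair $(Q,R)$ is controllable. Consider the second-order system $\Sigma$ with transfer function $W(s)=(C_1s+C_0)(Ms^2+Ds+K)^{-1}B$ and pole set $\Omega$. Then the following hold. (1) If $\sigma(S)\cap\Omega=\emptyset$, then the equation $$M\Pi S^2+D\Pi S+K\Pi=BL$$ has a unique solution $\Pi\in\mathbb{R}^{n\times\nu}$, and there is a one-to-one relation between the moments of $W$ at $\sigma(S)$ and the matrix $C_0\Pi+C_1\Pi S$. (2) If $\sigma(Q)\cap\Omega=\emptyset$, then the equation $$Q^2\Upsilon M+Q\Upsilon D+\Upsilon K=RC_0+QRC_1$$ has a unique solution $\Upsilon\in\mathbb{R}^{\nu\times n}$, and there is a one-to-one relation between the moments of $W$ at $\sigma(Q)$ and the matrix $\Upsilon B$.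
   Context: $\Sigma$ is the single-input single-output second-order system $M\ddot x+D\dot x+Kx=Bu$, $y=C_1\dot x+C_0x$, with $M,D,K\in\mathbb{R}^{n\times n}$, $B\in\mathbb{R}^{n}$, $C_0,C_1\in\mathbb{R}^{1\times n}$. $\Omega=\{s\in\mathbb{C}:\det(Ms^2+Ds+K)=0\}$, assumed to consist of $2n$ points counted with multiplicity. $\sigma(A)$ denotes the set of eigenvalues of $A$. Moments: for $s_\star\in\mathbb{C}\setminus\Omega$, the $k$-moment of $W$ at $s_\star$ is $\eta_k(s_\star)=\frac{(-1)^k}{k!}\left[\frac{d^k}{ds^k}W(s)\right]_{s=s_\star}$, $k\ge 0$. The moments of $W$ at $\sigma(S)$ are the numbers $\eta_0(\lambda),\dots,\eta_{m_\lambda-1}(\lambda)$, where $\lambda$ ranges over the distinct eigenvalues of $S$ and $m_\lambda$ is the algebraic multiplicity of $\lambda$; similarly for $\sigma(Q)$. One-to-one relation: for a fixed pair $(L,S)$ (respectively $(Q,R)$), the moments are uniquely determined by the elements of the matrix, and vice versa. That is, for any two single-input single-output second-order systems, each of the form $M\ddot x+D\dot x+Kx=Bu$, $y=C_1\dot x+C_0x$, with its own coefficient matrices $M,D,K\in\mathbb{R}^{n\times n}$, $B\in\mathbb{R}^{n}$, $C_0,C_1\in\mathbb{R}^{1\times n}$ such that its pole set $\{s\in\mathbb{C}:\det(Ms^2+Ds+K)=0\}$ consists of $2n$ points counted with multiplicity, and whose pole sets are disjoint from $\sigma(S)$ (respectively $\sigma(Q)$), their moments at $\sigma(S)$ (respectively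 $\sigma(Q)$) coincide if and only if the corresponding matrices $C_0\Pi+C_1\Pi S$ (respectively $\Upsilon B$) coincide. *)

(* Defs.v *)
From HB Require Import structures.
From mathcomp Require Import all_boot all_order all_algebra.
From mathcomp Require Import complex.
From mathcomp Require Import all_classical all_reals all_analysis.
Import Order.TTheory GRing.Theory Num.Theory.
Import numFieldNormedType.Exports.

Set Implicit Arguments.
Unset Strict Implicit.
Unset Printing Implicit Defensive.

Local Open Scope classical_set_scope.
Local Open Scope ring_scope.
Local Open Scope complex_scope.

(* M x'' + D x' + K x = B u,  y = C1 x' + C0 x. *)
Record so_system (R : realType) (n : nat) : Type := SOSystem {
  so_M : 'M[R]_n;
  so_D : 'M[R]_n;
  so_K : 'M[R]_n;
  so_B : 'cV[R]_n;
  so_C0 : 'rV[R]_n;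
  so_C1 : 'rV[R]_n
}.

Definition cplx (R : realType) (m n : nat) (A : 'M[R]_(m, n)) :
    'M[R[i]]_(m, n) :=
  map_mx (real_complex R) A.

Definition so_pencil (R : realType) (n : nat) (Sg : so_system R n) (s : R[i]) :
    'M[R[i]]_n :=
  s ^+ 2 *: cplx (so_M Sg) + s *: cplx (so_D Sg) + cplx (so_K Sg).

Definition poles (R : realType) (n : nat) (Sg : so_system R n) : set R[i] :=
  [set s | \det (so_pencil Sg s) = 0].

(* The determinant of the pencil as a polynomial in s: it is what gives the
   poles their multiplicities. *)
Definition so_charpoly (R : realType) (n : nat) (Sg : so_system R n) :
    {poly R[i]} :=
  \det ('X^2 *: map_mx polyC (cplx (so_M Sg))
        + 'X *: map_mx polyC (cplx (so_D Sg))
        + map_mx polyC (cplx (so_K Sg))).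

(* An identically zero determinant is excluded: its pole set would be
   infinite. *)
Definition full_poles (R : realType) (n : nat) (Sg : so_system R n) : Prop :=
  exists rs : seq R[i],
    [/\ uniq rs, poles Sg = [set` rs]
      & (\sum_(s <- rs) mup s (so_charpoly Sg))%N = (2 * n)%N].

(* At a pole invmx returns its argument, so the value there is junk; elsewhere
   the poles being isolated makes every derivative the expected one. *)
Definition transfer (R : realType) (n : nat) (Sg : so_system R n) (s : R[i]) :
    R[i] :=
  ((s *: cplx (so_C1 Sg) + cplx (so_C0 Sg)) *m invmx (so_pencil Sg s)
     *m cplx (so_B Sg)) 0 0.

(* R[i]^o is R[i] as a normed module over itself, so these are complex
   derivatives. *)
Definition cderiven (R : realType) (k : nat) (W : R[i] -> R[i]) :
    R[i] -> R[i] :=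
  derive1n k (W : R[i] -> R[i]^o).

Definition moment (R : realType) (W : R[i] -> R[i]) (k : nat) (s : R[i]) :
    R[i] :=
  (-1) ^+ k / k`!%:R * cderiven k W s.

Definition spectrum (R : realType) (nu : nat) (A : 'M[R]_nu) : set R[i] :=
  [set l | eigenvalue (cplx A) l].

Definition same_moments (R : realType) (nu : nat) (A : 'M[R]_nu)
    (W1 W2 : R[i] -> R[i]) : Prop :=
  forall l : R[i], spectrum A l ->
  forall k : nat, (k < mup l (char_poly (cplx A)))%N ->
    moment W1 k l = moment W2 k l.

(* The matrix whose rows are L, L S, ..., L S^(nu-1) has full rank. *)
Definition observable (R : realType) (nu : nat) (L : 'rV[R]_nu)
    (S : 'M[R]_nu) : Prop :=
  \rank (\matrix_(i < nu) (L *m S ^+ i)) = nu.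

(* The matrix whose columns are b, Q b, ..., Q^(nu-1) b has full rank. *)
Definition controllable (R : realType) (nu : nat) (Q : 'M[R]_nu)
    (b : 'cV[R]_nu) : Prop :=
  \rank (\matrix_(i < nu, j < nu) (Q ^+ j *m b) i 0) = nu.

Definition Pi_equation (R : realType) (n nu : nat) (Sg : so_system R n)
    (L : 'rV[R]_nu) (S : 'M[R]_nu) (Pi : 'M[R]_(n, nu)) : Prop :=
  so_M Sg *m Pi *m S ^+ 2 + so_D Sg *m Pi *m S + so_K Sg *m Pi
    = so_B Sg *m L.

Definition Upsilon_equation (R : realType) (n nu : nat) (Sg : so_system R n)
    (Q : 'M[R]_nu) (b : 'cV[R]_nu) (Ups : 'M[R]_(nu, n)) : Prop :=
  Q ^+ 2 *m Ups *m so_M Sg + Q *m Ups *m so_D Sg + Ups *m so_K Sg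
    = b *m so_C0 Sg + Q *m b *m so_C1 Sg.

Definition one_to_one_Pi (R : realType) (n nu : nat) (L : 'rV[R]_nu)
    (S : 'M[R]_nu) : Prop :=
  forall (Sg1 Sg2 : so_system R n) (Pi1 Pi2 : 'M[R]_(n, nu)),
    full_poles Sg1 -> full_poles Sg2 ->
    spectrum S `&` poles Sg1 = set0 -> spectrum S `&` poles Sg2 = set0 ->
    Pi_equation Sg1 L S Pi1 -> Pi_equation Sg2 L S Pi2 ->
    (same_moments S (transfer Sg1) (transfer Sg2) <->
     so_C0 Sg1 *m Pi1 + so_C1 Sg1 *m Pi1 *m S
       = so_C0 Sg2 *m Pi2 + so_C1 Sg2 *m Pi2 *m S).

Definition one_to_one_Upsilon (R : realType) (n nu : nat) (Q : 'M[R]_nu)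
    (b : 'cV[R]_nu) : Prop :=
  forall (Sg1 Sg2 : so_system R n) (Ups1 Ups2 : 'M[R]_(nu, n)),
    full_poles Sg1 -> full_poles Sg2 ->
    spectrum Q `&` poles Sg1 = set0 -> spectrum Q `&` poles Sg2 = set0 ->
    Upsilon_equation Sg1 Q b Ups1 -> Upsilon_equation Sg2 Q b Ups2 ->
    (same_moments Q (transfer Sg1) (transfer Sg2) <->
     Ups1 *m so_B Sg1 = Ups2 *m so_B Sg2).

(* Main.v *)
(* Let polynomial matrices G = sum_j G_j s^j act on X by
   G . X = sum_j G_j X S^j.  Since this is an action, P . Pi = B L with
   P = M s^2 + D s + K is solved with the adjugate of P: adj P . (P . Pi) is
   Pi d(S), where d = det P, and d(S) is invertible because d is coprime to the
   characteristic polynomial chi of S.  In the same way, writing W = N / d, the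
   matrix C0 Pi + C1 Pi S, multiplied by d(S), equals L N(S).  For two systems
   these matrices therefore agree iff L E(S) = 0 with E = N1 d2 - N2 d1, which
   by observability means that chi divides E.  On the other hand W1 - W2 is
   E / (d1 d2), so the moments agree at an eigenvalue l up to its multiplicity m
   iff (s - l)^m divides E.  The second part follows by transposition. *)
Require Import Defs.
From HB Require Import structures.
From mathcomp Require Import all_boot all_order all_algebra.
From mathcomp Require Import complex ring.
From mathcomp Require Import all_classical all_reals all_analysis.
Import Order.TTheory GRing.Theory Num.Theory.
Import numFieldNormedType.Exports.
Set Implicit Arguments.
Unset Strict Implicit.
Unset Printing Implicit Defensive.

Local Open Scope classical_set_scope.
Local Open Scope ring_scope.

(** * The action of polynomial matrices through a square matrix *)

Section PolyAction.
Variables (F : comNzRingType) (nu : nat) (S : 'M[F]_nu.+1).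

(* The action [G . X = sum_j G_j X S^j] of a polynomial matrix
   [G = sum_j G_j 'X^j], written entrywise.  With [P = M 'X^2 + D 'X + K] the
   equation of the theorem is [P . Pi = B L]. *)
Definition poly_act (p n : nat) (G : 'M[{poly F}]_(p, n)) (X : 'M[F]_(n, nu.+1)) :
    'M[F]_(p, nu.+1) :=
  \matrix_i \sum_l row l X *m horner_mx S (G i l).

(** Evaluation at [S] acts on the right and so reverses the factors; commutativity of [{poly F}]
    puts them back in order. *)
Lemma poly_actM (q p n : nat) (G : 'M[{poly F}]_(q, p)) (H : 'M[{poly F}]_(p, n))
    (X : 'M[F]_(n, nu.+1)) :
  poly_act (G *m H) X = poly_act G (poly_act H X).
Proof.
apply/row_matrixP => i; rewrite !rowK.
under [RHS]eq_bigr do rewrite rowK mulmx_suml.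
rewrite exchange_big; apply: eq_bigr => l _ /=.
rewrite mxE rmorph_sum mulmx_sumr; apply: eq_bigr => k _.
by rewrite /= [G i k * _]mulrC rmorphM /= -mulmxA.
Qed.

Lemma poly_actD (p n : nat) (G H : 'M[{poly F}]_(p, n)) (X : 'M[F]_(n, nu.+1)) :
  poly_act (G + H) X = poly_act G X + poly_act H X.
Proof.
apply/row_matrixP => i; rewrite linearD /= !rowK -big_split.
by apply: eq_bigr => l _; rewrite mxE rmorphD mulmxDr.
Qed.

Lemma poly_actZ (p n : nat) (a : {poly F}) (G : 'M[{poly F}]_(p, n))
    (X : 'M[F]_(n, nu.+1)) :
  poly_act (a *: G) X = poly_act G X *m horner_mx S a.
Proof.
apply/row_matrixP => i; rewrite row_mul !rowK mulmx_suml.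
by apply: eq_bigr => l _; rewrite mxE mulrC rmorphM mulmxA.
Qed.

Lemma poly_act_mulr (p n : nat) (G : 'M[{poly F}]_(p, n)) (X : 'M[F]_(n, nu.+1))
    (a : {poly F}) :
  poly_act G (X *m horner_mx S a) = poly_act G X *m horner_mx S a.
Proof.
apply/row_matrixP => i; rewrite row_mul !rowK mulmx_suml.
apply: eq_bigr => l _; rewrite row_mul -!mulmxA; congr (_ *m _).
exact: comm_horner_mx2.
Qed.

Lemma poly_actC (p n : nat) (A : 'M[F]_(p, n)) (X : 'M[F]_(n, nu.+1)) :
  poly_act (map_mx polyC A) X = A *m X.
Proof.
apply/row_matrixP => i; rewrite !rowK row_mul mulmx_sum_row.
by apply: eq_bigr => l _; rewrite !mxE horner_mx_C mul_mx_scalar.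
Qed.

Lemma poly_act_scalar (n : nat) (a : {poly F}) (X : 'M[F]_(n, nu.+1)) :
  poly_act a%:M X = X *m horner_mx S a.
Proof.
by rewrite -scalemx1 poly_actZ -(map_mx1 polyC) poly_actC mul1mx.
Qed.

Lemma poly_act1 (a : 'M[{poly F}]_1) (L : 'rV[F]_nu.+1) :
  poly_act a L = L *m horner_mx S (a 0 0).
Proof. by rewrite [a]mx11_scalar poly_act_scalar mxE eqxx. Qed.

End PolyAction.

(** * Solving [P . X = Y] by Bezout and the adjugate *)

Section PolyActionSolve.
Variables (F : fieldType) (nu n : nat) (S : 'M[F]_nu.+1) (P : 'M[{poly F}]_n).
Hypothesis copr : coprimep (\det P) (char_poly S).

(** In a Bezout identity evaluated at [S], Cayley-Hamilton kills the term with [char_poly S]; the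
    other one exhibits an inverse. *)
Lemma horner_mx_unit (p : {poly F}) :
  coprimep p (char_poly S) -> horner_mx S p \in unitmx.
Proof.
case/Bezout_eq1_coprimepP => -[u v] /= /(congr1 (horner_mx S)).
rewrite rmorphD !rmorphM /= Cayley_Hamilton mulr0 addr0 rmorph1.
by case/mulmx1_unit.
Qed.

(** Cramer's rule for the action: up to the factor [horner_mx S (\det P)], any [H . X] can be read
    off from [P . X]. *)
Lemma poly_act_adj (p : nat) (H : 'M[{poly F}]_(p, n)) (X : 'M[F]_(n, nu.+1)) :
  poly_act S H X *m horner_mx S (\det P) = poly_act S (H *m \adj P) (poly_act S P X).
Proof. by rewrite -poly_actM -mulmxA mul_adj_mx poly_actM poly_act_scalar poly_act_mulr. Qed.

Lemma poly_act_ex_unique (Y : 'M[F]_(n, nu.+1)) :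
  exists! X : 'M[F]_(n, nu.+1), poly_act S P X = Y.
Proof.
have dU := horner_mx_unit copr.
have inj (X X' : 'M[F]_(n, nu.+1)) : poly_act S P X = poly_act S P X' -> X = X'.
  move=> /(congr1 (poly_act S (\adj P))); rewrite -!poly_actM mul_adj_mx !poly_act_scalar.
  exact: (can_inj (mulmxK dU)).
have [[u v] /= /(congr1 (horner_mx S))] := Bezout_eq1_coprimepP _ _ copr.
rewrite rmorphD !rmorphM /= Cayley_Hamilton mulr0 addr0 rmorph1 => ud.
(* [P *m (u *: \adj P)] is the scalar matrix of [u * \det P], which takes the value 1 at [S]. *)
have PX : poly_act S P (poly_act S (u *: \adj P) Y) = Y.
  rewrite -poly_actM -scalemxAr mul_mx_adj scale_scalar_mx poly_act_scalar.
  by rewrite rmorphM /= ud mulmx1.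
exists (poly_act S (u *: \adj P) Y); split=> // X XY.
by apply: inj; rewrite PX XY.
Qed.

End PolyActionSolve.

(** * Observability and annihilating polynomials *)

Section Observable.
Variables (F : fieldType) (nu : nat) (S : 'M[F]_nu.+1) (L : 'rV[F]_nu.+1).
Hypothesis obs : \rank (\matrix_(i < nu.+1) (L *m S ^+ i)) = nu.+1.

(** Only the remainder [r] of [p] modulo [char_poly S] matters. It has degree at most [nu], so
    [L *m horner_mx S r] combines the independent rows [L *m S ^+ i] with the coefficients of
    [r]. *)
Lemma observable_horner_eq0 (p : {poly F}) :
  L *m horner_mx S p = 0 <-> char_poly S %| p.
Proof.
split; last first.
  case/dvdpP => q ->.
  by rewrite rmorphM /= Cayley_Hamilton mulr0 mulmx0.
rewrite {1}(divp_eq p (char_poly S)) rmorphD rmorphM /= Cayley_Hamilton.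
rewrite mulr0 add0r => Lr; rewrite /dvdp; set r := p %% _ in Lr *.
have rsz : (size r <= nu.+1)%N.
  by rewrite -ltnS -(size_char_poly S) ltn_modp -size_poly_gt0 size_char_poly.
have : poly_rV r *m (\matrix_(i < nu.+1) (L *m S ^+ i)) = 0.
  rewrite -[RHS]Lr mulmx_sum_row -[in RHS](poly_rV_K rsz) /rVpoly poly_def.
  rewrite rmorph_sum mulmx_sumr; apply: eq_bigr => i _.
  rewrite rowK /= horner_mxZ rmorphXn /= horner_mx_X -scalemxAr; congr (_ *: _).
  by rewrite insubT // => h; congr (poly_rV r 0 _); apply: val_inj.
move/eqP; rewrite mulmx_free_eq0 /row_free ?obs // => /eqP /(congr1 rVpoly).
by rewrite poly_rV_K // linear0 => ->.
Qed.

End Observable.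

(** * Derivatives of a rational function and orders of vanishing *)

Section Quotient.
Variables (K : numFieldType) (e : {poly K}).

Lemma is_derive_horner (p : {poly K}) (x : K) :
  is_derive x (1 : K) (horner p : K -> K^o) p^`().[x].
Proof.
elim/poly_ind: p => [|p c ih].
  have -> : horner (0 : {poly K}) = cst 0 by apply/funext => y; rewrite horner0.
  by rewrite deriv0 horner0; exact: is_derive_cst.
have -> : horner (p * 'X + c%:P) = (horner p : K -> K^o) * id + cst c.
  by apply/funext => y; rewrite !(hornerE, fctE).
apply: is_derive_eq.
rewrite derivD derivM derivX derivC !hornerE /= ?addr0 [x *: _]mulrC [p.[x] *: _]mulr1.
by rewrite addrC.
Qed.

Lemma near_horner_neq0 (x : K) : e.[x] != 0 -> \forall y \near x, e.[y] != 0.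
Proof.
move=> ex0.
have [/derivable1_diffP/differentiable_continuous ce _] := is_derive_horner e x.
exact: cvgr_neq0 ce ex0.
Qed.

Lemma derive_horner_div (p q : {poly K}) (x : K) : q.[x] != 0 ->
  'D_1 (fun y => p.[y] / q.[y] : K^o) x =
  (p^`() * q - p * q^`()).[x] / q.[x] ^+ 2.
Proof.
move=> qx0.
have [dp Dp] := is_derive_horner p x; have [dq Dq] := is_derive_horner q x.
rewrite (deriveM (f := horner p) (g := fun y => (horner q y)^-1)) //; last exact: derivableV.
rewrite (deriveV (f := horner q)) // Dp Dq !hornerE.
rewrite -![_ *: _]/(_ * _).
by field.
Qed.

(* The numerators of the successive derivatives of [N / e] over the
   denominators [e ^+ k.+1]. *)
Fixpoint quot_num (N : {poly K}) (k : nat) : {poly K} :=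
  if k is j.+1 then
    (quot_num N j)^`() * e - (quot_num N j * e^`()) *+ j.+1
  else N.

(** The values of [f] at the zeros of [e] are arbitrary: the complement of these zeros is open, so
    derivatives there see only the formula. *)
Lemma derive1n_quot (f : K -> K^o) (N : {poly K}) :
  (forall x, e.[x] != 0 -> f x = N.[x] / e.[x]) ->
  forall k x, e.[x] != 0 ->
    derive1n k f x = (quot_num N k).[x] / e.[x] ^+ k.+1.
Proof.
move=> fE; elim=> [|k ih] x ex0; first by rewrite derive1n0 expr1 fE.
rewrite derive1nS derive1E.
have -> : 'D_1 (derive1n k f) x =
    'D_1 (fun y => (quot_num N k).[y] / (e ^+ k.+1).[y] : K^o) x.
  apply: near_eq_derive.
  near=> y; rewrite ih ?horner_exp //.
  by near: y; exact: near_horner_neq0.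
rewrite derive_horner_div ?horner_exp ?expf_neq0 //.
rewrite deriv_exp /= !(hornerE, hornerMn) expr2.
rewrite !(exprS e.[x]); set a := e.[x] ^+ k.
have a0 : a != 0 by rewrite expf_neq0.
by field; rewrite a0 ex0.
Unshelve. all: by end_near. Qed.

Lemma quot_num0 (k : nat) : quot_num 0 k = 0.
Proof. by elim: k => //= k ->; rewrite deriv0 !mul0r mul0rn subrr. Qed.

(** Each differentiation lowers the order of vanishing at [x] by exactly one. *)
Lemma quot_num_XsubC (x : K) (G : {poly K}) (j k : nat) :
  e.[x] != 0 -> G.[x] != 0 -> (k <= j)%N ->
  exists2 H : {poly K}, H.[x] != 0 &
    quot_num (G * ('X - x%:P) ^+ j) k = H * ('X - x%:P) ^+ (j - k).
Proof.
move=> ex0 Gx0; elim: k => [|k ih] kj; first by exists G; rewrite ?subn0.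
have [H Hx0 /= ->] := ih (ltnW kj).
rewrite -[(j - k)%N]prednK ?subn_gt0 // -subnS; set i := (j - k.+1)%N.
(* The product rule on [H * ('X - x%:P) ^+ i.+1], with [('X - x%:P) ^+ i] factored out. At [x] only
   the middle term survives, and it is nonzero in characteristic 0. *)
exists (H^`() * ('X - x%:P) * e + (H * e) *+ i.+1 -
        (H * ('X - x%:P) * e^`()) *+ k.+1).
  rewrite !(hornerE, hornerMn) subrr !(mulr0, mul0r) mul0rn subr0 add0r.
  by rewrite -mulr_natr !mulf_neq0 // pnatr_eq0.
rewrite derivM deriv_exp derivXsubC /= exprS; ring.
Qed.

(** If a nonzero [N] vanishes to order [j] at [x], its numerators vanish there for [k < j] but not
    for [k = j]; both sides then say [m <= j]. *)
Lemma dvdp_XsubC_quot_num (x : K) (N : {poly K}) (m : nat) : e.[x] != 0 ->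
  (forall k, (k < m)%N -> (quot_num N k).[x] = 0) <-> ('X - x%:P) ^+ m %| N.
Proof.
move=> ex0; have [j [G]] := multiplicity_XsubC N x.
have [-> _ _|N0 /= Gx0 NE] := eqVneq N 0.
  by split=> // _ k _; rewrite quot_num0 horner0.
have {}Gx0 : G.[x] != 0 by [].
have -> : ('X - x%:P) ^+ m %| N = (m <= j)%N.
  rewrite -mup_geq // NE mupMr //.
  by rewrite mup_XsubCX eqxx.
rewrite NE; split=> [h|mj k km].
  rewrite leqNgt; apply/negP => jm.
  have [H Hx0 E] := quot_num_XsubC ex0 Gx0 (leqnn j).
  move: (h j jm); rewrite E subnn expr0 mulr1 => /eqP.
  by rewrite (negbTE Hx0).
have kj := leq_trans km mj.
have [H _ ->] := quot_num_XsubC ex0 Gx0 (ltnW kj).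
by rewrite hornerM horner_exp !hornerE subrr expr0n subn_eq0 leqNgt kj mulr0.
Qed.

End Quotient.

(** The linear factors of [p] are cancelled from [q] one at a time, each lowering the multiplicity
    in [q] of its own root only. *)
Lemma dvdp_mup (F : closedFieldType) (p q : {poly F}) : p != 0 ->
  (forall x, ('X - x%:P) ^+ mup x p %| q) <-> p %| q.
Proof.
move=> p0; split=> [|pq x]; last first.
  by apply: dvdp_trans pq; rewrite -mup_geq.
have [-> _|q0] := eqVneq q 0; first exact: dvdp0.
have [s pE] := closed_field_poly_normal p.
have lp0 : lead_coef p != 0 by rewrite lead_coef_eq0.
have mupE x : mup x p = count_mem x s.
  by rewrite pE -mul_polyC mupMr ?mu_prod_XsubC // rootE hornerC.
move=> h; rewrite pE dvdpZl //.
have {h}: forall x, (count_mem x s <= mup x q)%N.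
  by move=> x; rewrite -mupE mup_geq.
elim: s q q0 {p p0 pE lp0 mupE} => [|x s ih] q q0 h; first by rewrite big_nil dvd1p.
have : 'X - x%:P %| q by rewrite XsubC_dvd //; apply: leq_trans (h x); rewrite /= eqxx.
case/dvdpP => q1 qE; move: q0 h; rewrite qE mulf_eq0 negb_or => /andP[q10 x0] h.
rewrite big_cons mulrC dvdp_mul2r //; apply: ih => // y; move: (h y).
by rewrite mupM // (@mup_XsubCX _ 1) /= addnC; case: eqP => _; rewrite ?leq_add2r ?addn0.
Qed.

Lemma char_poly_trmx (F : comNzRingType) n (A : 'M[F]_n) :
  char_poly A^T = char_poly A.
Proof.
rewrite /char_poly -[in RHS]det_tr; congr (\det _).
by rewrite /char_poly_mx linearB /= tr_scalar_mx map_trmx.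
Qed.

Lemma trmx_exp (F : comNzRingType) n (A : 'M[F]_n.+1) k : (A ^+ k)^T = A^T ^+ k.
Proof.
elim: k => [|k ih]; first by rewrite !expr0 trmx1.
by rewrite exprS trmx_mul ih [RHS]exprSr.
Qed.

(** * Equality of moments as a divisibility *)

Section Core.
Variables (R : realType) (nu : nat) (S : 'M[R]_nu.+1).
Local Notation rc := (real_complex R).

Lemma mup_notin_spectrum (l : R[i]) :
  ~ spectrum S l -> mup l (char_poly (cplx S)) = 0%N.
Proof.
by move=> nl; apply: mupNroot; rewrite -eigenvalue_root_char; apply/negP.
Qed.

Lemma same_momentsP (N1 d1 N2 d2 : {poly R}) (W1 W2 : R[i] -> R[i]) :
  coprimep d1 (char_poly S) -> coprimep d2 (char_poly S) ->
  (forall s, (map_poly rc d1).[s] != 0 ->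
     W1 s = (map_poly rc N1).[s] / (map_poly rc d1).[s]) ->
  (forall s, (map_poly rc d2).[s] != 0 ->
     W2 s = (map_poly rc N2).[s] / (map_poly rc d2).[s]) ->
  same_moments S W1 W2 <-> char_poly S %| N1 * d2 - N2 * d1.
Proof.
move=> c1 c2 W1E W2E.
set E := N1 * d2 - N2 * d1.
have e0 l : spectrum S l -> (map_poly rc (d1 * d2)).[l] != 0.
  rewrite /spectrum /= eigenvalue_root_char -map_char_poly => rl.
  rewrite rmorphM hornerM mulf_neq0 //;
    by rewrite (coprimep_root _ rl) // coprimep_map coprimep_sym.
(* Over the common denominator [d1 * d2] the derivatives of both functions have equal denominators,
   and their numerators can be subtracted. *)
have WE (N : {poly R}) W d d' : (forall s, (map_poly rc d).[s] != 0 ->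
     W s = (map_poly rc N).[s] / (map_poly rc d).[s]) ->
   forall s, (map_poly rc (d * d')).[s] != 0 ->
     W s = (map_poly rc (N * d')).[s] / (map_poly rc (d * d')).[s].
  move=> WE s; rewrite !rmorphM !hornerM mulf_eq0 negb_or => /andP[ds d's].
  by rewrite WE // -mulf_div divff // mulr1.
have {}W1E := WE _ _ _ d2 W1E.
have {}W2E := WE _ _ _ d1 W2E.
rewrite (mulrC d2) in W2E.
have quot_numB (e p q : {poly R[i]}) k :
    quot_num e (p - q) k = quot_num e p k - quot_num e q k.
  by elim: k => //= k ->; rewrite derivB; ring.
have momE l k : spectrum S l -> (moment W1 k l = moment W2 k l) <->
    (quot_num (map_poly rc (d1 * d2)) (map_poly rc E) k).[l] = 0.
  move=> /e0 el; rewrite /moment /cderiven.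
  rewrite (derive1n_quot W1E) // (derive1n_quot W2E) //.
  rewrite rmorphB quot_numB hornerD hornerN; split.
    move/mulfI => h; apply/eqP; rewrite subr_eq0; apply/eqP.
    have /mulIf : (((map_poly rc (d1 * d2)).[l] ^+ k.+1)^-1 != 0).
      by rewrite invr_eq0 expf_neq0.
    apply; apply: h.
    by rewrite mulf_neq0 ?signr_eq0 // invr_eq0 pnatr_eq0 -lt0n fact_gt0.
  by move/eqP; rewrite subr_eq0 => /eqP ->.
(* Divisibility is insensitive to the extension from [R] to [R[i]], where it can be tested root by
   root. *)
rewrite -(dvdp_map rc) map_char_poly -/(cplx S).
rewrite -dvdp_mup ?monic_neq0 ?char_poly_monic //.
split=> [h l|h l sl k kl].
  have [sl|/mup_notin_spectrum ->] := pselect (spectrum S l); last first.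
    by rewrite expr0 dvd1p.
  apply: (proj1 (dvdp_XsubC_quot_num _ _ (e0 l sl))) => k kl.
  by apply/(momE _ _ sl); exact: h.
by apply/(momE _ _ sl); move: k kl; apply: (proj2 (dvdp_XsubC_quot_num _ _ (e0 l sl))).
Qed.

Variables (L : 'rV[R]_nu.+1).
Hypothesis obs : \rank (\matrix_(i < nu.+1) (L *m S ^+ i)) = nu.+1.

(** Input [G] and output [H] are left arbitrary so that the same statement serves the transposed
    equation, where they trade places. *)
Lemma same_moments_poly_act n (P1 P2 : 'M[{poly R}]_n) (G1 G2 : 'cV[{poly R}]_n)
    (H1 H2 : 'rV[{poly R}]_n) (X1 X2 : 'M[R]_(n, nu.+1)) (W1 W2 : R[i] -> R[i]) :
  coprimep (\det P1) (char_poly S) -> coprimep (\det P2) (char_poly S) ->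
  (forall s, (map_poly rc (\det P1)).[s] != 0 ->
     W1 s = (map_poly rc ((H1 *m \adj P1 *m G1) 0 0)).[s]
            / (map_poly rc (\det P1)).[s]) ->
  (forall s, (map_poly rc (\det P2)).[s] != 0 ->
     W2 s = (map_poly rc ((H2 *m \adj P2 *m G2) 0 0)).[s]
            / (map_poly rc (\det P2)).[s]) ->
  poly_act S P1 X1 = poly_act S G1 L -> poly_act S P2 X2 = poly_act S G2 L ->
  same_moments S W1 W2 <-> poly_act S H1 X1 = poly_act S H2 X2.
Proof.
move=> c1 c2 W1E W2E X1E X2E.
rewrite (same_momentsP c1 c2 W1E W2E) -(observable_horner_eq0 obs).
have out P G (H : 'rV_n) X : poly_act S P X = poly_act S G L ->
    poly_act S H X *m horner_mx S (\det P) =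
    L *m horner_mx S ((H *m \adj P *m G) 0 0).
  by move=> XE; rewrite poly_act_adj XE -poly_actM poly_act1.
rewrite rmorphB !rmorphM /= mulmxBr !mulmxA -(out _ _ _ _ X1E) -(out _ _ _ _ X2E).
have dC : horner_mx S (\det P1) *m horner_mx S (\det P2) =
    horner_mx S (\det P2) *m horner_mx S (\det P1) := comm_horner_mx2 _ _ _.
rewrite -!mulmxA dC.
have U1 := horner_mx_unit c1; have U2 := horner_mx_unit c2.
split=> [/eqP|->]; last by rewrite subrr.
rewrite subr_eq0 => /eqP; rewrite !mulmxA => /(can_inj (mulmxK U1)).
by move/(can_inj (mulmxK U2)).
Qed.

End Core.

(** * The system as polynomial matrices *)

Section System.
Variables (R : realType) (n : nat).
Implicit Types Sg : so_system R n.
Local Notation rc := (real_complex R).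

(** Coefficients stay in [R] because the solutions sought are real. *)
Definition real_pencil Sg : 'M[{poly R}]_n :=
  'X^2 *: map_mx polyC (so_M Sg) + 'X *: map_mx polyC (so_D Sg)
  + map_mx polyC (so_K Sg).

Definition real_output Sg : 'rV[{poly R}]_n :=
  'X *: map_mx polyC (so_C1 Sg) + map_mx polyC (so_C0 Sg).

Definition real_input Sg : 'cV[{poly R}]_n := map_mx polyC (so_B Sg).

Definition transfer_num Sg : {poly R} :=
  (real_output Sg *m \adj (real_pencil Sg) *m real_input Sg) 0 0.

(** Bundled as a ring morphism, so that it commutes with determinants, adjugates and products. *)
Definition real_eval (s : R[i]) : {rmorphism {poly R} -> R[i]} :=
  horner_eval s \o map_poly rc.

Lemma map_real_eval m p (s : R[i]) (A : 'M[R]_(m, p)) :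
  map_mx (real_eval s) (map_mx polyC A) = cplx A.
Proof.
by apply/matrixP => i j; rewrite !mxE /= map_polyC horner_evalE hornerC.
Qed.

Lemma real_evalX (s : R[i]) : real_eval s 'X = s.
Proof. by rewrite /= map_polyX horner_evalE hornerX. Qed.

Lemma so_pencilE Sg s : so_pencil Sg s = map_mx (real_eval s) (real_pencil Sg).
Proof.
by rewrite !map_mxD !map_mxZ !map_real_eval rmorphXn real_evalX.
Qed.

Lemma det_so_pencil Sg s :
  \det (so_pencil Sg s) = (map_poly rc (\det (real_pencil Sg))).[s].
Proof. by rewrite so_pencilE det_map_mx. Qed.

Lemma transferE Sg s : (map_poly rc (\det (real_pencil Sg))).[s] != 0 ->
  transfer Sg s = (map_poly rc (transfer_num Sg)).[s]
                  / (map_poly rc (\det (real_pencil Sg))).[s].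
Proof.
move=> ds; rewrite /transfer /invmx unitmxE det_so_pencil unitfE ds.
rewrite -scalemxAr -scalemxAl mxE mulrC; congr (_ / _).
have -> : s *: cplx (so_C1 Sg) + cplx (so_C0 Sg) =
    map_mx (real_eval s) (real_output Sg).
  by rewrite map_mxD map_mxZ !map_real_eval real_evalX.
rewrite so_pencilE -map_mx_adj -(map_real_eval s (so_B Sg)) -!map_mxM.
by rewrite mxE.
Qed.

(** A common complex root would be both an eigenvalue and a pole; coprimality descends from [R[i]]
    to [R]. *)
Lemma coprimep_pencil nu (S : 'M[R]_nu) Sg : spectrum S `&` poles Sg = set0 ->
  coprimep (\det (real_pencil Sg)) (char_poly S).
Proof.
move=> SP0; rewrite coprimep_sym -(coprimep_map rc) map_char_poly.
apply: Pdiv.ClosedField.root_coprimep => l rl; apply/eqP => dl.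
have : (spectrum S `&` poles Sg) l.
  by split; rewrite /spectrum /poles /= ?eigenvalue_root_char ?det_so_pencil.
by rewrite SP0.
Qed.

End System.

(** * Both halves of the theorem for positive [nu] *)

Section PositiveDimension.
Variables (R : realType) (n nu : nat) (S : 'M[R]_nu.+1).
Implicit Types (Sg : so_system R n) (L : 'rV[R]_nu.+1) (b : 'cV[R]_nu.+1).

Lemma poly_act_real_pencil Sg (X : 'M[R]_(n, nu.+1)) :
  poly_act S (real_pencil Sg) X =
  so_M Sg *m X *m S ^+ 2 + so_D Sg *m X *m S + so_K Sg *m X.
Proof. by rewrite !poly_actD !poly_actZ !poly_actC rmorphXn /= horner_mx_X. Qed.

Lemma Pi_equationE Sg L (X : 'M[R]_(n, nu.+1)) :
  Pi_equation Sg L S X <->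
  poly_act S (real_pencil Sg) X = poly_act S (real_input Sg) L.
Proof. by rewrite poly_act_real_pencil poly_actC. Qed.

Lemma poly_act_real_output Sg (X : 'M[R]_(n, nu.+1)) :
  poly_act S (real_output Sg) X = so_C0 Sg *m X + so_C1 Sg *m X *m S.
Proof. by rewrite poly_actD poly_actZ !poly_actC horner_mx_X addrC. Qed.

(** Transposition turns left multiplication by [S] into the right action of [S^T], with the output
    polynomial as new input. *)
Lemma Upsilon_equationE Sg b (Y : 'M[R]_(nu.+1, n)) :
  Upsilon_equation Sg S b Y <->
  poly_act S^T (real_pencil Sg)^T Y^T = poly_act S^T (real_output Sg)^T b^T.
Proof.
have -> : (real_pencil Sg)^T = 'X^2 *: map_mx polyC (so_M Sg)^T
    + 'X *: map_mx polyC (so_D Sg)^T + map_mx polyC (so_K Sg)^T.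
  by rewrite !linearD !linearZ /= !map_trmx.
have -> : (real_output Sg)^T =
    'X *: map_mx polyC (so_C1 Sg)^T + map_mx polyC (so_C0 Sg)^T.
  by rewrite linearD linearZ /= !map_trmx.
rewrite !poly_actD !poly_actZ !poly_actC rmorphXn /= horner_mx_X -trmx_exp -!trmx_mul.
rewrite -!linearD /= !mulmxA [S *m b *m _ + _]addrC.
by rewrite /Upsilon_equation; split=> [->|/trmx_inj].
Qed.

Lemma same_moments_trmx (W1 W2 : R[i] -> R[i]) :
  same_moments S^T W1 W2 <-> same_moments S W1 W2.
Proof.
have cE : char_poly (cplx S^T) = char_poly (cplx S).
  by rewrite -char_poly_trmx /cplx -map_trmx trmxK.
by rewrite /same_moments /spectrum /=; split=> h l; have := h l;
  rewrite /= !eigenvalue_root_char cE.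
Qed.

Lemma spectrum_trmx : spectrum S^T = spectrum S.
Proof.
apply/funext => l; rewrite /spectrum /= !eigenvalue_root_char.
by rewrite -char_poly_trmx /cplx -map_trmx trmxK.
Qed.

Lemma observable_trmx b : controllable S b -> observable b^T S^T.
Proof.
rewrite /controllable /observable -mxrank_tr => h; rewrite -[RHS]h; congr (\rank _).
apply/row_matrixP => i; rewrite rowK -trmx_exp -trmx_mul.
by apply/rowP => j; rewrite !mxE.
Qed.

Lemma Pi_theorem L Sg : observable L S -> spectrum S `&` poles Sg = set0 ->
  (exists! X : 'M[R]_(n, nu.+1), Pi_equation Sg L S X) /\ one_to_one_Pi n L S.
Proof.
move=> obs SP0; split.
  have [X [XE Xu]] := poly_act_ex_unique (coprimep_pencil SP0)
    (poly_act S (real_input Sg) L).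
  by exists X; split=> [|X' /Pi_equationE /Xu //]; apply/Pi_equationE.
move=> Sg1 Sg2 X1 X2 _ _ SP1 SP2 /Pi_equationE E1 /Pi_equationE E2.
rewrite -!poly_act_real_output.
apply: (same_moments_poly_act obs _ _ _ _ E1 E2); try exact: coprimep_pencil.
- exact: transferE.
- exact: transferE.
Qed.

Lemma Upsilon_theorem b Sg : controllable S b ->
  spectrum S `&` poles Sg = set0 ->
  (exists! Y : 'M[R]_(nu.+1, n), Upsilon_equation Sg S b Y) /\
  one_to_one_Upsilon n S b.
Proof.
move=> /observable_trmx obs.
have copr Sg' : spectrum S `&` poles Sg' = set0 ->
    coprimep (\det (real_pencil Sg')^T) (char_poly S^T).
  by rewrite -spectrum_trmx det_tr; exact: coprimep_pencil.
(* A 1 by 1 matrix is its own transpose, so the dual system has the same transfer function. *)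
have trE Sg' s : (map_poly (real_complex R) (\det (real_pencil Sg')^T)).[s] != 0 ->
    transfer Sg' s =
    (map_poly (real_complex R) (((real_input Sg')^T *m \adj (real_pencil Sg')^T
       *m (real_output Sg')^T) 0 0)).[s]
    / (map_poly (real_complex R) (\det (real_pencil Sg')^T)).[s].
  rewrite det_tr -trmx_adj -!trmx_mul mulmxA mxE; exact: transferE.
move=> /copr SP0; split.
  have [X [XE Xu]] := poly_act_ex_unique SP0 (poly_act S^T (real_output Sg)^T b^T).
  exists X^T; split=> [|Y /Upsilon_equationE /Xu ->]; last by rewrite trmxK.
  by apply/Upsilon_equationE; rewrite trmxK.
move=> Sg1 Sg2 Y1 Y2 _ _ /copr SP1 /copr SP2.
move=> /Upsilon_equationE E1 /Upsilon_equationE E2.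
rewrite -same_moments_trmx.
rewrite (same_moments_poly_act obs SP1 SP2 (trE Sg1) (trE Sg2) E1 E2).
rewrite /real_input !map_trmx !poly_actC -!trmx_mul.
by split=> [/trmx_inj|->].
Qed.

End PositiveDimension.

(** Eigenvectors are nonzero, so in dimension 0 there is no eigenvalue and no moment to compare. *)
Lemma same_moments_dim0 (R : realType) (A : 'M[R]_0) (W1 W2 : R[i] -> R[i]) :
  same_moments A W1 W2.
Proof. by move=> l /eigenvalueP [v _]; rewrite [v]thinmx0 eqxx. Qed.

Theorem theorem1 (R : realType) (n nu : nat)
    (S : 'M[R]_nu) (L : 'rV[R]_nu) (Q : 'M[R]_nu) (b : 'cV[R]_nu)
    (obsLS : observable L S) (ctrQb : controllable Q b)
    (Sg : so_system R n) (polesSg : full_poles Sg) :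
  (spectrum S `&` poles Sg = set0 ->
     (exists! Pi : 'M[R]_(n, nu), Pi_equation Sg L S Pi) /\
     one_to_one_Pi n L S) /\
  (spectrum Q `&` poles Sg = set0 ->
     (exists! Ups : 'M[R]_(nu, n), Upsilon_equation Sg Q b Ups) /\
     one_to_one_Upsilon n Q b).
Proof.
(* The action is set up for positive sizes; for size 0 both solutions and both compared matrices are
   empty. *)
case: nu => [|nu] in S L Q b obsLS ctrQb *; last first.
  by split; [exact: Pi_theorem | exact: Upsilon_theorem].
split=> _; split.
- exists 0; split=> [|X _]; last by rewrite [X]thinmx0.
  by rewrite /Pi_equation [LHS]thinmx0 [RHS]thinmx0.
- move=> Sg1 Sg2 X1 X2 *; split=> _; first by rewrite [LHS]thinmx0 [RHS]thinmx0.
  exact: same_moments_dim0.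
- exists 0; split=> [|X _]; last by rewrite [X]flatmx0.
  by rewrite /Upsilon_equation [LHS]flatmx0 [RHS]flatmx0.
- move=> Sg1 Sg2 X1 X2 *; split=> _; first by rewrite [LHS]flatmx0 [RHS]flatmx0.
  exact: same_moments_dim0.
Qed.
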